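(* Let $G$ be a countably infinite discrete amenable group and $(X,G)$ a $G$-action on a nonempty compact metric space $(X,d)$. Let $\{F_n\}_{n\in\mathbb N}$ be a tempered F\o lner sequence of $G$ with constant $C$, satisfying $\lim_{n\to\infty}\frac{|F_n|}{\log n}=+\infty$ and $e_G\in F_n$ for every $n\in\mathbb N$. Let $\mathcal{U}$ be a finite open cover of $X$ and $\eta>0$. Assume that $\lambda\in\mathbb R$ satisfies $$\sup_{x\in X}h_{\mathrm{dim}}(\Gamma_\eta(x),\mathcal{U},\{F_n\}_{n\in\mathbb N})<\lambda.$$ Then, for each sufficiently small $\delta>0$, there exists $P\in\mathbb N$ such that, for all $n>P$, $$\sup_{x\in X}N(\mathcal{U}^{F_n},B^{F_n}_\eta(x))\le|\mathcal{U}|^{(\delta+\delta^{1/4})|F_n|}\,\mathrm{e}^{\lambda|F_n|}\,2^{\delta|F_n|}.$$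
   Context: $e_G$ is the identity of $G$, $\mathfrak{F}_G$ the collection of finite nonempty subsets of $G$. A F\o lner sequence is $\{F_n\}_{n\in\mathbb{N}}\subset\mathfrak{F}_G$ with $\lim_{n\to\infty}\frac{|F_n\cap gF_n|}{|F_n|}=1$ for each $g\in G$; $G$ is amenable if one exists. The sequence is tempered with constant $C>0$ if $\left|\bigcup_{k<n}F_k^{-1}F_n\right|\le C|F_n|$ for every $n\ge2$. A $G$-action $(X,G)$ is a nonempty compact metric space $(X,d)$ with $G$ acting by self-homeomorphisms ($e_G$ acting as the identity). For $F\in\mathfrak{F}_G$: $d_F(x,y)=\max_{g\in F}d(gx,gy)$, and $B^F_\eta(x)=\{y\in X:d_F(x,y)\le\eta\}$. $\Gamma_\eta(x)=\{y\in X:d(gx,gy)\le\eta\ \forall g\in G\}$. For a finite open cover $\mathcal{U}$ of $X$ and $F\in\mathfrak{F}_G$, $\mathcal{U}^F=\bigvee_{g\in F}g^{-1}\mathcal{U}$ is the join (all sets $\bigcap_{g\in F}g^{-1}U_g$ with $U_g\in\mathcal{U}$). For $K\subset X$, $N(\mathcal{U}^F,K)$ is the minimal cardinality of a subfamily of $\mathcal{U}^F$ covering $K$. For nonempty $Z\subset X$ and $\lambda,\varepsilon>0$, $F_{\lambda,\varepsilon}(\mathcal{U},Z,\{F_n\}_{n\in\mathbb N})=\inf\sum_{i\in I}\exp(-\lambda|F_{n_i}|)$, the infimum over all finite or countable families $\{B_i\}_{i\in I}$ covering $Z$ with each $B_i\in\mathcal{U}^{F_{n_i}}$ for some $n_i$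 with $|F_{n_i}|\ge\frac1\varepsilon$. Put $F_\lambda(\mathcal{U},Z,\{F_n\})=\lim_{\varepsilon\to0}F_{\lambda,\varepsilon}(\mathcal{U},Z,\{F_n\})$ and $h_{\mathrm{dim}}(Z,\mathcal{U},\{F_n\}_{n\in\mathbb N})=\inf\{\lambda>0:F_\lambda(\mathcal{U},Z,\{F_n\})=0\}$. *)

(* Defs.v *)
From HB Require Import structures.
From mathcomp Require Import all_boot all_order all_algebra finmap.
From mathcomp Require Import all_classical all_reals all_analysis.

Set Implicit Arguments.
Unset Strict Implicit.
Unset Printing Implicit Defensive.

Import Order.TTheory GRing.Theory Num.Theory.
Import numFieldNormedType.Exports.

Local Open Scope classical_set_scope.
Local Open Scope ring_scope.

(* Sequences of finite subsets of G are functions on nat read on the indices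
   n = 1, 2, 3, ...: the value at index 0 is never used. *)

Section Group.
Context (R : realType) (G : groupType).
Implicit Type F : nat -> {fset G}.

Definition lmul_fset (g : G) (A : {fset G}) : {fset G} :=
  [fset (g * x)%g | x in A]%fset.

Definition invmul_fset (A B : {fset G}) : {fset G} :=
  [fset (x^-1 * y)%g | x in A, y in B]%fset.

Definition folner F : Prop :=
  (forall n, (0 < n)%N -> F n != fset0) /\
  (forall g : G,
     (#|` F n `&` lmul_fset g (F n)|%fset%:R / #|` F n|%:R : R)
       @[n --> \oo] --> (1 : R)).

Definition amenable : Prop := exists F, folner F.

Definition tempered (C : R) F : Prop :=
  0 < C /\
  forall n, (2 <= n)%N ->
    #|` (\bigcup_(k <- index_iota 1 n) invmul_fset (F k) (F n))%fset|%:R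
      <= C * #|` F n|%:R.

End Group.

Section Action.
Context (R : realType) (G : groupType) (X : metricType R) (act : G -> X -> X).
Implicit Types (A : {fset G}) (F : nat -> {fset G}) (U : {fset set X}).

(* Each [act g] is then a homeomorphism, with inverse [act g^-1]. *)
Record group_action : Prop := {
  act_id : forall x, act 1%g x = x;
  act_mul : forall g h x, act (g * h)%g x = act g (act h x);
  act_continuous : forall g, continuous (act g) }.

(* The seed 0 does not affect the maximum: distances are nonnegative and A is
   nonempty in every use. *)
Definition bowen_dist A (x y : X) : R :=
  \big[Num.max/0]_(g <- A) mdist (act g x) (act g y).

Definition bowen_ball A (eta : R) (x : X) : set X :=
  [set y | bowen_dist A x y <= eta].

Definition Gamma (eta : R) (x : X) : set X :=
  [set y | forall g, mdist (act g x) (act g y) <= eta].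

Definition open_cover U : Prop :=
  (forall V, V \in U -> open V) /\ [set: X] `<=` \bigcup_(V in [set` U]) V.

Definition join_cover U A : set (set X) :=
  [set B | exists c : G -> set X, (forall g, g \in A -> c g \in U) /\
     B = \bigcap_(g in [set` A]) (act g @^-1` c g)].

(* The infimum is over a set of natural numbers, hence a minimum whenever some
   finite subfamily covers K, and +oo otherwise. *)
Definition cover_number (W : set (set X)) (K : set X) : \bar R :=
  ereal_inf [set (#|` V|%:R)%:E | V in
    [set V : {fset set X} |
       [set` V] `<=` W /\ K `<=` \bigcup_(B in [set` V]) B]].

(* Finite or countable families are indexed by subsets I of nat. *)
Definition dim_premeasure_eps U (Z : set X) F (lambda eps : R) : \bar R :=
  ereal_inf [set s | exists (I : set nat) (B : nat -> set X) (m : nat -> nat),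
    [/\ forall i, I i ->
          [/\ (0 < m i)%N, eps^-1 <= #|` F (m i)|%:R
            & join_cover U (F (m i)) (B i)],
        Z `<=` \bigcup_(i in I) B i
      & s = (\esum_(i in I) (expR (- (lambda * #|` F (m i)|%:R)))%:E)%E]].

Definition dim_premeasure U (Z : set X) F (lambda : R) : \bar R :=
  lim (dim_premeasure_eps U Z F lambda eps @[eps --> 0^'+]).

Definition hdim (Z : set X) U F : \bar R :=
  ereal_inf [set lambda%:E | lambda in
    [set l : R | 0 < l /\ dim_premeasure U Z F l = 0%E]].

End Action.

(* Main.v *)
(* Fix lam' < lam still bounding the dimensions of all Gamma_eta(z); the gap
   lam - lam' absorbs every error term, whence the bound exp(lam |F_n|), in which
   delta plays no role. By compactness, for all N and s > 0 there are a finite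
   set A and, for every z, finitely many cylinders in U^(F_m), m >= N, that cover
   B^A_eta(z) and satisfy sum exp(-lam' |F_m|) <= s. If A g lies in F_n and y in
   B^(F_n)_eta(x), then g y lies in one of the cylinders for g x, which places a
   tile F_m g in F_n. A greedy selection, from the largest index down,
   gives almost disjoint tiles covering, by temperedness, a fixed proportion of
   the centers; repeating it with finitely many layers of rapidly growing indices
   covers F_n up to a small proportion. So y lies in an element of U^(F_n)
   determined by the selected tiles, their cylinders and the elements of U chosen
   at the uncovered positions, and the weights exp(-lam' |F_m|) bound the number
   of these codes. *)
Require Import Defs.
From HB Require Import structures.
From mathcomp Require Import all_boot all_order all_algebra finmap.
From mathcomp Require Import all_classical all_reals all_analysis.
From mathcomp Require Import lra ring.

Set Implicit Arguments.
Unset Strict Implicit.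
Unset Printing Implicit Defensive.

Import Order.TTheory GRing.Theory Num.Theory.
Import numFieldNormedType.Exports.

Local Open Scope classical_set_scope.
Local Open Scope ring_scope.

(** * Cardinalities of finite sets *)

Section FsetCard.
Variable T : choiceType.

Lemma card_fset_count (A : {fset T}) (P : pred T) :
  (#|` [fset x in A | P x]%fset| = \sum_(x <- A) P x)%N.
Proof.
rewrite -big_mkcond sum1_count /= -size_filter.
apply/eqP; rewrite eqn_leq; apply/andP; split; apply: uniq_leq_size.
- exact: fset_uniq.
- by move=> x; rewrite mem_filter !inE andbC.
- by rewrite filter_uniq// fset_uniq.
- by move=> x; rewrite mem_filter !inE andbC.
Qed.

Lemma card_fsetI_sum (A B : {fset T}) :
  (#|` A `&` B|%fset = \sum_(x <- B) (x \in A))%N.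
Proof.
rewrite -card_fset_count; congr (#|` _|).
by apply/fsetP => x; rewrite !inE andbC.
Qed.

Lemma leq_card_fsetU (A B : {fset T}) :
  (#|` A `|` B|%fset <= #|` A| + #|` B|)%N.
Proof. by rewrite cardfsU leq_subr. Qed.

Lemma card_bigfcup_le (I : Type) (r : seq I) (P : pred I) (f : I -> {fset T}) :
  (#|` \bigcup_(i <- r | P i) f i|%fset <= \sum_(i <- r | P i) #|` f i|)%N.
Proof.
elim/big_rec2: _ => [|i n A _ le_An]; first by rewrite cardfs0.
by rewrite (leq_trans (leq_card_fsetU _ _))// leq_add2l.
Qed.

End FsetCard.

(** * Translates of finite subsets of a group *)

Section Translates.
Variable G : groupType.
Implicit Types A B : {fset G}.

Definition rtrans A (g : G) : {fset G} := [fset (x * g)%g | x in A]%fset.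

Lemma in_rtrans A g x : (x \in rtrans A g) = ((x * g^-1)%g \in A).
Proof.
apply/imfsetP/idP => [[y yA ->]|xA]; first by rewrite mulgK.
by exists (x * g^-1)%g => //; rewrite mulgVK.
Qed.

Lemma card_rtrans A g : #|` rtrans A g| = #|` A|.
Proof. by rewrite card_imfset//; exact: mulIg. Qed.

Lemma in_lmul g A x : (x \in lmul_fset g A) = ((g^-1 * x)%g \in A).
Proof.
apply/imfsetP/idP => [[y yA ->]|xA]; first by rewrite mulKg.
by exists (g^-1 * x)%g => //; rewrite mulVKg.
Qed.

Lemma card_lmul g A : #|` lmul_fset g A| = #|` A|.
Proof. by rewrite card_imfset//; exact: mulgI. Qed.

(* A point y lies in at most |B| of the translates B a. *)
Lemma sum_card_rtransI A B Y :
  (\sum_(a <- A) #|` rtrans B a `&` Y|%fset <= #|` B| * #|` Y|)%N.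
Proof.
under eq_bigr do rewrite card_fsetI_sum.
rewrite exchange_big /= mulnC.
rewrite [leqRHS](_ : _ = \sum_(y <- Y) #|` B|)%N; last first.
  by rewrite big_const_seq count_predT iter_addn_0 mulnC.
apply: leq_sum => y _.
rewrite -card_fset_count; set D := [fset x in A | _]%fset.
have inj : injective (fun a : G => (y * a^-1)%g) by move=> a b /mulgI /invg_inj.
have <- : #|` [fset (y * a^-1)%g | a in D]%fset| = #|` D|.
  by rewrite (card_imfset _ _ inj).
apply: fsubset_leq_card; apply/fsubsetP => x /imfsetP[a /=].
by rewrite !inE => /andP[_]; rewrite in_rtrans => yaB ->.
Qed.

Definition tiles (F : nat -> {fset G}) (m : G -> nat) (D : {fset G}) :=
  (\bigcup_(d <- D) rtrans (F (m d)) d)%fset.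

End Translates.

(** * Boundaries and almost invariance *)

Section Boundary.
Variables (R : realType) (G : groupType).
Implicit Types A B E : {fset G}.
Local Notation card A := (#|` A|%fset%:R : R).

(** This counts the pairs [(a, b)] in [A] times [B] with [a b] outside [B]. Being a sum over [A], it
    is controlled term by term by the Følner condition. *)
Definition boundary A B : R := \sum_(a <- A) card (B `\` lmul_fset a^-1 B).

Definition almost_invariant (gam : R) A B := boundary A B <= gam * card B.

Lemma boundary_ge0 A B : 0 <= boundary A B.
Proof. by apply: sumr_ge0 => a _. Qed.

Lemma almost_invariantW gam A A' B :
  (A' `<=` A)%fset -> almost_invariant gam A B -> almost_invariant gam A' B.
Proof.
move=> A'A; apply: le_trans; rewrite /boundary.
rewrite (big_fsetID _ (mem A') A) /= (_ : [fset x in A | x \in A']%fset = A').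
  by rewrite lerDl sumr_ge0.
apply/fsetP => x; rewrite !inE /= andbC.
by have [/(fsubsetP A'A) ->|] := boolP (x \in A').
Qed.

Lemma card_inner_boundary A B :
  card (\bigcup_(a <- A) (B `\` lmul_fset a^-1 B)) <= boundary A B.
Proof. by rewrite /boundary -natr_sum ler_nat card_bigfcup_le. Qed.

(** Left translation preserves cardinality, so [a^-1 B] minus [B] has as many points as [B] minus
    [a^-1 B]; one quantity thus bounds both sides of the boundary. *)
Lemma card_outer_boundary A B :
  card (\bigcup_(a <- A) (lmul_fset a^-1 B `\` B)) <= boundary A B.
Proof.
rewrite /boundary -natr_sum ler_nat.
apply: leq_trans (card_bigfcup_le _ _ _) _.
by apply: leq_sum => a _; rewrite !cardfsD card_lmul fsetIC.
Qed.

(** If [g] is in [T] but [a g] is not, then either [a g] leaves [E], and [g] is in the inner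
    boundary of [E], or [a g] enters a tile that misses [g], and [g] is in the outer boundary of
    that tile. *)
Lemma card_bad_centers gam (I : eqType) (r : seq I) (B : I -> {fset G})
    (d : I -> G) A E T :
  T = (E `\` \bigcup_(i <- r) rtrans (B i) (d i))%fset ->
  almost_invariant gam A E ->
  {in r, forall i, almost_invariant gam A (B i)} ->
  card [fset g in T | ~~ all (fun a => (a * g)%g \in T) A] <=
    gam * (card E + \sum_(i <- r) card (B i)).
Proof.
move=> TE invE invB.
pose outer i := (\bigcup_(a <- A) (lmul_fset a^-1 (B i) `\` B i))%fset.
pose inner := (\bigcup_(a <- A) (E `\` lmul_fset a^-1 E))%fset.
pose outers := (\bigcup_(i <- r) rtrans (outer i) (d i))%fset.
apply: (@le_trans _ _ (card (inner `|` outers))).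
  rewrite ler_nat; apply: fsubset_leq_card; apply/fsubsetP => g.
  rewrite !inE /= TE => /andP[]; rewrite inE => /andP[gS gE] /allPn[a aA].
  rewrite !inE negb_and negbK => /orP[/bigfcupP[i /andP[ir _]]|agE].
    rewrite in_rtrans => agB; apply/orP; right.
    apply/bigfcupP; exists i; rewrite ?ir// in_rtrans.
    apply/bigfcupP; exists a; rewrite ?aA// in_fsetD in_lmul invgK mulgA agB.
    rewrite andbT; apply: contra gS => gB.
    by apply/bigfcupP; exists i; rewrite ?ir// in_rtrans.
  apply/orP; left; apply/bigfcupP; exists a; rewrite ?aA//.
  by rewrite in_fsetD in_lmul invgK agE.
apply: (@le_trans _ _ (card inner + card outers)).
  by rewrite -natrD ler_nat leq_card_fsetU.
rewrite mulrDr lerD//; first exact: le_trans (card_inner_boundary A E) invE.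
rewrite mulr_sumr; apply: (@le_trans _ _ (\sum_(i <- r) card (outer i))).
  rewrite -natr_sum ler_nat; apply: leq_trans (card_bigfcup_le _ _ _) _.
  by apply: leq_sum => i _; rewrite card_rtrans.
rewrite big_seq [leRHS]big_seq; apply: ler_sum => i ir.
exact: le_trans (card_outer_boundary A (B i)) (invB i ir).
Qed.

Lemma folner_almost_invariant (F : nat -> {fset G}) A gam :
  folner R F -> 0 < gam ->
  exists N, forall n, (N <= n)%N -> (0 < n)%N -> almost_invariant gam A (F n).
Proof.
move=> [Fne Finv] gam0.
(* [u n] is [boundary A (F n)] divided by the size of [F n]. *)
pose u n : R := \sum_(a <- A)
  (1 - card (F n `&` lmul_fset a^-1 (F n))%fset / card (F n)).
have : u n @[n --> \oo] --> (\sum_(a <- A) (1 - 1) : R).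
  apply: (cvg_big add_continuous) => a _.
  by apply: cvgB; [exact: cvg_cst|exact: Finv].
rewrite big1 => [|a _]; last by rewrite subrr.
move=> /cvgrPdist_lt/(_ _ gam0)[N _ HN]; exists N => n Nn n0.
have := HN n Nn; rewrite /= sub0r normrN => /(le_lt_trans (ler_norm _)).
have Fn : 0 < card (F n) by rewrite ltr0n cardfs_gt0 Fne.
rewrite -(ltr_pM2r Fn) => /ltW; apply: le_trans.
rewrite /u mulr_suml; apply: ler_sum => a _.
rewrite mulrBl mul1r mulfVK ?gt_eqF// -natrB ?cardfsD//.
exact: fsubset_leq_card (fsubsetIl _ _).
Qed.

End Boundary.

(** * Almost disjoint tilings from temperedness *)

Section Tiling.
Variables (R : realType) (G : groupType) (F : nat -> {fset G}) (C : R).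
Local Notation card A := (#|` A|%fset%:R : R).

(** Induction on a list sorted by increasing index decides the head last, so tiles are examined from
    the largest index down. A tile is kept when the kept ones cover at most a proportion [eps] of
    it: each kept tile then adds a proportion [1 - eps] of new points, and each rejected one is
    covered beyond [eps] by tiles of at least its index. *)
Lemma eps_disjoint_tiles (eps : R) (m : G -> nat) (s : seq G) :
  0 <= eps < 1 -> {in s, forall a, F (m a) != fset0} ->
  sorted (fun a b => (m a <= m b)%N) s -> uniq s ->
  exists D : {fset G},
    [/\ {subset D <= s},
        (1 - eps) * (\sum_(d <- D) card (F (m d))) <= card (tiles F m D)
      & {in s, forall a, eps * card (F (m a)) < card (rtrans (F (m a)) a `&`
           \bigcup_(d <- D | (m a <= m d)%N) rtrans (F (m d)) d)}].
Proof.
move=> /andP[eps0 eps1]; elim: s => [|a s IH] Fne /= sort_s uniq_s.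
  by exists fset0; split; rewrite // ?/tiles ?big_seq_fset0 ?mulr0.
have /andP[a_s us] := uniq_s.
have trm : transitive (fun a b => (m a <= m b)%N).
  by move=> y x z; exact: leq_trans.
have le_a b : b \in s -> (m a <= m b)%N.
  by move=> bs; have /allP/(_ b bs) := order_path_min trm sort_s.
have Fne_s : {in s, forall b, F (m b) != fset0}.
  by move=> b bs; apply: Fne; rewrite inE bs orbT.
have [D [Ds Dcard Dcov]] := IH Fne_s (path_sorted sort_s) us.
have Sa : (\bigcup_(d <- D | (m a <= m d)%N) rtrans (F (m d)) d)%fset
    = tiles F m D.
  rewrite big_seq_cond [RHS]big_seq_cond; apply: eq_bigl => d.
  by have [/Ds/le_a ->|] := boolP (d \in D).
have [lt_a|ge_a] := ltP (eps * card (F (m a)))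
    (card (rtrans (F (m a)) a `&` tiles F m D)).
  exists D; split => // [d /Ds ds|b]; first by rewrite inE ds orbT.
  by rewrite inE => /predU1P[->|/Dcov//]; rewrite Sa.
have aD : a \notin D by apply: contra a_s => /Ds.
exists (a |` D)%fset; split.
- by move=> d; rewrite !inE => /predU1P[->|/Ds ->]; rewrite ?eqxx// orbT.
- rewrite /tiles !big_fsetU1//= -/(tiles F m D).
  have := cardfsUI (rtrans (F (m a)) a) (tiles F m D).
  rewrite card_rtrans => /(congr1 (fun n => n%:R : R)); rewrite !natrD.
  move: ge_a Dcard; lra.
(* The newly kept tile covers itself entirely, which exceeds the proportion [eps] because
   [eps < 1]. *)
move=> b; rewrite inE => /predU1P[->|bs].
  rewrite (fsetIidPl _) ?card_rtrans; last first.
    by apply: bigfcup_sup; rewrite ?in_fset1U ?eqxx //.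
  have /Fne : a \in a :: s by rewrite inE eqxx.
  by rewrite -cardfs_gt0 -(ltr0n R) => ?; rewrite gtr_pMl.
apply: (lt_le_trans (Dcov b bs)); rewrite ler_nat; apply: fsubset_leq_card.
apply: fsetIS; apply/bigfcupsP => d dD mbd.
by apply: bigfcup_sup; rewrite ?in_fset1U ?dD ?orbT //.
Qed.

Hypothesis temp : forall n, (0 < n)%N ->
  card (\bigcup_(k <- index_iota 1 n) invmul_fset (F k) (F n)) <= C * card (F n).

(* Each center in A is charged to the selected tiles that meet its own tile: a
   tile of larger index receives at most C times its size by temperedness, one
   of the same index at most eps^-1 times its size by double counting. *)
Lemma disjoint_tiles (eps : R) (m : G -> nat) (A : {fset G}) :
  0 < eps < 1 -> {in A, forall a, (0 < m a)%N /\ F (m a) != fset0} ->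
  exists D : {fset G},
    [/\ {subset D <= A},
        (1 - eps) * (\sum_(d <- D) card (F (m d))) <= card (tiles F m D)
      & card A <= (C + eps^-1) * (\sum_(d <- D) card (F (m d)))].
Proof.
move=> /andP[eps0 eps1] Am.
pose s := sort (fun a b => (m a <= m b)%N) (enum_fset A).
have sA x : (x \in s) = (x \in A) by rewrite mem_sort.
have eps01 : 0 <= eps < 1 by rewrite ltW.
have sm : {in s, forall a, F (m a) != fset0} by move=> a; rewrite sA => /Am[].
have sort_s : sorted (fun a b => (m a <= m b)%N) s.
  by apply: sort_sorted => a b; exact: leq_total.
have uniq_s : uniq s by rewrite sort_uniq fset_uniq.
have [D [Ds Dcard Dcov]] := eps_disjoint_tiles eps01 sm sort_s uniq_s.
exists D; split => // [d /Ds|]; first by rewrite sA.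
pose meet a d := (rtrans (F (m a)) a `&` rtrans (F (m d)) d)%fset.
(* [k a d] is the charge that center [a] puts on [d]: a unit for a meeting tile of larger index, a
   share of the overlap for equal index. *)
pose k a d : R := if (m a < m d)%N then (meet a d != fset0)%:R
  else if m a == m d then card (meet a d) / (eps * card (F (m d))) else 0.
have k0 a d : 0 <= k a d.
  rewrite /k; case: ifP => // _; case: ifP => // _.
  by rewrite divr_ge0// mulr_ge0// ltW.
have ge1 a : a \in A -> 1 <= \sum_(d <- D) k a d.
  move=> aA; have [m0 Fa0] := Am a aA.
  have Fa : 0 < card (F (m a)) by rewrite ltr0n cardfs_gt0.
  (* One meeting tile of larger index already pays 1. Otherwise all the overlap, which exceeds [eps]
     times the tile, comes from equal indices, and the normalization of [k] makes the shares sum to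
     at least 1. *)
  have [/hasP[d dD /andP[mad ne]]|/hasPn none] :=
      boolP (has (fun d => (m a < m d)%N && (meet a d != fset0)) (enum_fset D)).
    by rewrite (big_fsetD1 d)//= {1}/k mad ne lerDl sumr_ge0.
  have := Dcov a; rewrite sA => /(_ aA)/ltW le_a.
  have : card (rtrans (F (m a)) a `&`
      \bigcup_(d <- D | (m a <= m d)%N) rtrans (F (m d)) d) <=
      \sum_(d <- D) eps * card (F (m a)) * k a d.
    apply: (@le_trans _ _ (\sum_(d <- D | (m a <= m d)%N) card (meet a d))).
      rewrite -natr_sum ler_nat; apply: leq_trans (card_bigfcup_le _ _ _).
      apply: fsubset_leq_card; apply/fsubsetP => x.
      rewrite in_fsetI => /andP[xa /bigfcupP[d /andP[dD mad] xd]].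
      by apply/bigfcupP; exists d; rewrite ?dD// in_fsetI xa.
    rewrite big_mkcond big_seq [leRHS]big_seq; apply: ler_sum => d dD.
    have eF0 : 0 < eps * card (F (m a)) by rewrite mulr_gt0.
    case: ifP => [|_]; last by rewrite mulr_ge0// ltW.
    rewrite /k leq_eqVlt => /predU1P[mad|mad].
      by rewrite mad ltnn eqxx mulrC mulfVK// -mad gt_eqF.
    have := none d dD; rewrite mad /= negbK => /eqP ->.
    by rewrite cardfs0 eqxx mulr0.
  rewrite -mulr_sumr => /(le_trans le_a).
  by rewrite ler_pMr// mulr_gt0.
have le_k d : d \in D -> \sum_(a <- A) k a d <= (C + eps^-1) * card (F (m d)).
  move=> dD; have [m0 Fd0] : (0 < m d)%N /\ F (m d) != fset0.
    by apply: Am; rewrite -sA Ds.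
  have Fd : 0 < card (F (m d)) by rewrite ltr0n cardfs_gt0.
  have le2 a : k a d <= ((m a < m d)%N && (meet a d != fset0))%:R +
      (eps * card (F (m d)))^-1 *
        card (rtrans (F (m d)) a `&` rtrans (F (m d)) d).
    rewrite /k; have i0 : 0 <= (eps * card (F (m d)))^-1.
      by rewrite invr_ge0 mulr_ge0// ltW.
    case: ltnP => _ /=; first by rewrite lerDl mulr_ge0.
    case: eqP => [mad|_]; last by rewrite add0r mulr_ge0.
    by rewrite add0r mulrC /meet mad.
  apply: (le_trans (ler_sum _ (fun a _ => le2 a))); rewrite big_split /= mulrDl.
  apply: lerD; last first.
    rewrite -mulr_sumr ler_pdivrMl ?mulr_gt0// mulrA [_ * eps^-1]mulrAC.
    rewrite mulfV ?gt_eqF// mul1r.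
    have := sum_card_rtransI A (F (m d)) (rtrans (F (m d)) d).
    by rewrite card_rtrans -(ler_nat R) natr_sum natrM.
  apply: le_trans (temp m0); rewrite -natr_sum -card_fset_count ler_nat.
  rewrite -[leqRHS](card_rtrans _ d); apply: fsubset_leq_card; apply/fsubsetP => a.
  rewrite !inE /= => /andP[aA /andP[mad /fset0Pn[z]]].
  rewrite in_fsetI !in_rtrans => /andP[za zd].
  (* A common point [z] of the two tiles gives [a d^-1 = (z a^-1)^-1 (z d^-1)], an element of the
     product set in the temperedness condition. *)
  apply/bigfcupP; exists (m a).
    by rewrite mem_index_iota mad; have [->] := Am _ aA.
  apply/imfset2P; exists (z * a^-1)%g => //; exists (z * d^-1)%g => //.
  by rewrite invgM invgK -mulgA mulKg.
apply: (@le_trans _ _ (\sum_(a <- A) \sum_(d <- D) k a d)).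
  rewrite card_fset_sum1 natr_sum big_seq [leRHS]big_seq.
  exact: ler_sum.
rewrite exchange_big /= mulr_sumr big_seq [leRHS]big_seq.
exact: ler_sum.
Qed.

(** Layers are used from the highest down, so that the tiles already placed are almost invariant
    under the window [A l] of the next layer. Each layer covers a proportion [1 - q] of the
    remaining set, up to boundary effects. *)
Lemma multilayer_tiling (eps gam : R) (L : nat) (A : nat -> {fset G})
    (m : nat -> G -> nat) (E : {fset G}) :
  let q := 1 - (1 - eps) / (C + eps^-1) in
  let inside l g := {in A l, forall a, (a * g)%g \in E} in
  0 < eps <= 2^-1 -> 0 <= gam -> 0 <= C ->
  (forall l, (l < L)%N -> almost_invariant gam (A l) E) ->
  (forall l g, (l < L)%N -> inside l g ->
    [/\ (0 < m l g)%N, F (m l g) != fset0, (F (m l g) `<=` A l)%fset &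
        forall k, (k < l)%N -> almost_invariant gam (A k) (F (m l g))]) ->
  forall j, (j <= L)%N -> exists sel : seq (nat * G),
    let S := (\bigcup_(p <- sel) rtrans (F (m p.1 p.2)) p.2)%fset in
    [/\ uniq sel,
        {in sel, forall p, [/\ (L <= p.1 + j)%N, (p.1 < L)%N & inside p.1 p.2]},
        (1 - eps) * (\sum_(p <- sel) card (F (m p.1 p.2))) <= card S
      & card (E `\` S) <= (q ^+ j + 3 * gam) * card E].
Proof.
move=> q inside /andP[eps0 eps2] gam0 C0 invE layer.
have eps1 : eps < 1 by apply: le_lt_trans eps2 _; rewrite invf_lt1// ltr1n.
have ge1 : 1 <= eps^-1 by rewrite invf_ge1// ltW.
have Ceps : 0 < C + eps^-1 by rewrite ltr_wpDl// invr_gt0.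
have q1 : 1 - q = (1 - eps) / (C + eps^-1) by rewrite /q; ring.
have q1_ge0 : 0 <= 1 - q by rewrite q1 divr_ge0 ?ltW// subr_gt0.
have q0 : 0 <= q.
  by rewrite subr_ge0 ler_pdivrMr// mul1r; move: ge1 eps0 C0; lra.
elim=> [|j IH] jL.
  exists [::]; split; rewrite ?big_nil ?mulr0// fsetD0 expr0.
  by rewrite ler_peMl// lerDl mulr_ge0.
have [sel /= [uniq_sel selP selS selT]] := IH (ltnW jL).
set S := (\bigcup_(p <- sel) _)%fset in selS selT.
pose l := (L - j.+1)%N.
have Lj : L = (l + j.+1)%N by rewrite subnK.
have lL : (l < L)%N by rewrite Lj addnS ltnS leq_addr.
pose T := (E `\` S)%fset.
(* Centers whose whole window lies in the uncovered part: their tiles are disjoint from all earlier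
   ones. *)
pose Z := [fset g in T | all (fun a => (a * g)%g \in T) (A l)]%fset.
have ZT g a : g \in Z -> a \in A l -> (a * g)%g \in T.
  by rewrite inE /= => /andP[_ /allP Zg] /Zg.
have Zin g : g \in Z -> inside l g.
  by move=> gZ a al; have := ZT g a gZ al; rewrite inE => /andP[].
have eps01 : 0 < eps < 1 by rewrite eps0.
have Zm : {in Z, forall a, (0 < m l a)%N /\ F (m l a) != fset0}.
  by move=> a /Zin /(layer _ _ lL)[].
have [D [DZ Dcard Dcov]] := disjoint_tiles eps01 Zm.
have tT : (tiles F (m l) D `<=` T)%fset.
  apply/bigfcupsP => d /DZ dZ _; apply/fsubsetP => x; rewrite in_rtrans.
  have [_ _ /fsubsetP sub _] := layer _ _ lL (Zin _ dZ).
  by move=> /sub /(ZT _ _ dZ); rewrite mulgVK.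
have SE : (S `<=` E)%fset.
  apply/bigfcupsP => p /selP[_ pL pin] _; apply/fsubsetP => x.
  have [_ _ /fsubsetP sub _] := layer _ _ pL pin.
  by rewrite in_rtrans => /sub /pin; rewrite mulgVK.
have cardS : card E = card S + card T.
  by rewrite -natrD cardfsDS// subnKC// fsubset_leq_card.
have cardt : card T = card (tiles F (m l) D) + card (T `\` tiles F (m l) D).
  by rewrite -natrD cardfsDS// subnKC// fsubset_leq_card.
have disj : (tiles F (m l) D `&` S = fset0)%fset.
  apply/fsetP => x; rewrite !inE; apply/negP => /andP[/(fsubsetP tT)].
  by rewrite !inE => /andP[/negP].
have cardU : card (tiles F (m l) D `|` S) = card (tiles F (m l) D) + card S.
  by rewrite -natrD -cardfsUI disj cardfs0 addn0.
(* The factor 3 is one [card E] for the boundary of [E] and two for those of the tiles, whose sizes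
   sum to at most [card E / (1 - eps)], with [eps] at most one half. *)
have cardZ : card T <= card Z + 3 * gam * card E.
  have -> : card T = card Z +
      card [fset g in T | ~~ all (fun a => (a * g)%g \in T) (A l)]%fset.
    rewrite -natrD -(cardfsID Z T); congr (_%:R); congr addn; congr (#|` _|);
      apply/fsetP => g; rewrite !inE /=; case: (g \in E); case: (g \in S) => //=;
      by rewrite ?andbT ?andbF.
  rewrite lerD2l; apply: le_trans (card_bad_centers (erefl T) (invE l lL) _) _.
    move=> p /selP[pl pL pin]; have [_ _ _] := layer _ _ pL pin.
    by apply; rewrite -(leq_add2r j) addSnnS -Lj.
  rewrite [3 * gam]mulrC -mulrA ler_wpM2l//.
  have : (1 - 2^-1) * (\sum_(p <- sel) card (F (m p.1 p.2))) <=
      (1 - eps) * (\sum_(p <- sel) card (F (m p.1 p.2))).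
    by rewrite ler_wpM2r ?sumr_ge0// lerD2l lerN2.
  have : card S <= card E by rewrite cardS lerDl.
  by move: selS; lra.
have cov : (1 - q) * card Z <= card (tiles F (m l) D).
  rewrite q1 mulrAC ler_pdivrMr//.
  apply: le_trans (ler_wpM2l _ Dcov) _; first by rewrite subr_ge0 ltW.
  by rewrite mulrCA mulrC ler_wpM2r// ltW.
exists ([seq (l, g) | g <- D] ++ sel); split.
- rewrite cat_uniq uniq_sel map_inj_uniq ?fset_uniq ?andbT //=; last first.
    by move=> a b [].
  apply/hasPn => p /selP[pl _ _]; apply/negP => /mapP[g gD pE].
  by move: pl; rewrite pE Lj addnS ltnn.
- move=> p; rewrite mem_cat => /orP[/mapP[g gD ->]|/selP[? ? ?]].
    by split; [rewrite -Lj| |exact/Zin/DZ].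
  by split => //; rewrite addnS ltnW.
- by rewrite !big_cat !big_map /= -/S -/(tiles F (m l) D) cardU mulrDr lerD.
- rewrite !big_cat !big_map /= -/S -/(tiles F (m l) D) fsetUC -fsetDDl -/T.
  (* The uncovered size [t] becomes at most [q t + (1 - q) 3 gam card E], an affine recursion with
     fixed point [3 gam card E]. *)
  have := ler_wpM2l q1_ge0 cardZ; have := ler_wpM2l q0 selT; rewrite -/T.
  rewrite exprS; set x := q ^+ j; move: cov cardt; lra.
Qed.
End Tiling.

(** * Counting codes by their weights *)

Section Codes.
Variables (P : Type) (T : choiceType) (O : P -> seq T).

(** [None] records that no tile is selected at position [p]. *)
Definition options (p : P) : seq (option T) := None :: [seq Some t | t <- O p].

Fixpoint codes (ps : seq P) : seq (seq (option T)) :=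
  if ps is p :: ps' then
    [seq o :: c | o <- options p, c <- codes ps']
  else [:: [::]].

Lemma mem_codes (sigma : P -> option T) (ps : seq P) :
  (forall p t, sigma p = Some t -> t \in O p) -> map sigma ps \in codes ps.
Proof.
move=> sigmaO; elim: ps => [//|p ps IH]; apply/allpairsP.
exists (sigma p, map sigma ps); split => //=.
rewrite inE; case E : (sigma p) => [t|] //=.
by rewrite map_f// (sigmaO p).
Qed.

Variables (R : realType) (w : T -> R).

Definition cost (c : seq (option T)) : R := \sum_(o <- c) oapp w 0 o.

(** Costs add over positions, so the weights multiply and the sum factors; the summand 1 is the
    weight of [None]. *)
Lemma sum_codes (ps : seq P) :
  \sum_(c <- codes ps) expR (- cost c) =
  \prod_(p <- ps) (1 + \sum_(t <- O p) expR (- w t)).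
Proof.
rewrite /cost; elim: ps => [|p ps IH].
  by rewrite big_seq1 !big_nil oppr0 expR0.
rewrite big_cons -IH [LHS]big_allpairs_dep /= -/(codes ps).
rewrite big_cons big_map mulrDl mul1r mulr_suml; congr (_ + _).
  by apply: eq_bigr => c _; rewrite big_cons add0r.
apply: eq_bigr => t _; rewrite mulr_sumr; apply: eq_bigr => c _.
by rewrite big_cons opprD expRD.
Qed.

(** A Chernoff-type count: a code that occurs costs at most [b], so its weight is at least
    [expR (- b)], and the number of such codes is at most [expR b] times the total weight. One
    element of [W] per occurring code covers [K]. *)
Lemma cover_number_codes (X : metricType R) (W : set (set X)) (K : set X)
    (sigma : X -> P -> option T) (ps : seq P) (b : R) :
  (forall y p t, K y -> sigma y p = Some t -> t \in O p) ->
  (forall y, K y -> \sum_(p <- ps) oapp w 0 (sigma y p) <= b) ->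
  (forall y0, K y0 -> exists B, W B /\
     forall y, K y -> map (sigma y) ps = map (sigma y0) ps -> B y) ->
  (cover_number W K <=
    (expR b * \prod_(p <- ps) (1 + \sum_(t <- O p) expR (- w t)))%:E)%E.
Proof.
move=> sigmaO sigmab sigmaB.
pose used c := exists y, K y /\ map (sigma y) ps = c.
have /choice[f fP] : forall c, exists B, used c -> W B /\
    forall y, K y -> map (sigma y) ps = c -> B y.
  move=> c; have [[y0 [Ky0 <-]]|?] := pselect (used c); last by exists set0.
  by have [B BP] := sigmaB y0 Ky0; exists B.
pose cs := [seq c <- codes ps | `[< used c >]].
pose V : {fset set X} := [fset f c | c in cs]%fset.
apply: (@le_trans _ _ (#|` V|%fset%:R)%:E%E).
  apply: ereal_inf_lbound; exists V => //; split.
    move=> B /imfsetP[c /=]; rewrite mem_filter => /andP[/asboolP uc _] ->.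
    by have [] := fP c uc.
  move=> y Ky; have uy : used (map (sigma y) ps) by exists y.
  exists (f (map (sigma y) ps)); last by have [_ ] := fP _ uy; exact.
  apply/imfsetP; exists (map (sigma y) ps) => //=.
  rewrite mem_filter mem_codes ?andbT; first exact/asboolP.
  by move=> p t; exact: sigmaO.
rewrite lee_fin -sum_codes; apply: (@le_trans _ _ (size cs)%:R).
  by rewrite ler_nat (leq_trans (leq_imfset_card _ _ _))//= size_undup.
rewrite mulr_sumr size_filter -sum1_count natr_sum big_mkcond /=.
apply: ler_sum => c _; case: asboolP => [[y [Ky <-]]|_].
  rewrite -expRD -[leLHS]expR0 ler_expR subr_ge0 /cost big_map.
  exact: sigmab.
by rewrite mulr_ge0// ltW// expR_gt0.
Qed.
End Codes.


(** * Compactness and uniform families of cylinders *)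

(** Were the conclusion false, the complements of sets satisfying [P] would form a proper filter; at
    a cluster point the local hypothesis contradicts this. *)
Lemma compact_set_ind (T : topologicalType) (P : set T -> Prop) :
  compact [set: T] -> P set0 ->
  (forall A B, A `<=` B -> P B -> P A) ->
  (forall A B, P A -> P B -> P (A `|` B)) ->
  (forall x : T, exists2 V, nbhs x V & P V) -> P [set: T].
Proof.
move=> cT P0 Psub PU Ploc; apply: contrapT => PT.
have PF : ProperFilter [set W | P (~` W)].
  apply: Build_ProperFilter_ex.
    by move=> W PW; apply/set0P/eqP => W0; apply: PT; rewrite -setC0 -W0.
  split; first by rewrite /= setCT.
    by move=> A B PA PB; rewrite /= setCI; exact: PU.
  by move=> A B AB /=; apply: Psub; exact: subsetC.
have PT' : [set W | P (~` W)] [set: T] by rewrite /= setCT.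
have [p [_ clp]] := cT _ PF PT'.
have [V xV PV] := Ploc p.
have PV' : [set W | P (~` W)] (~` V) by rewrite /= setCK.
by have [q []] := clp _ _ PV' xV.
Qed.

Section Dynamics.
Context (R : realType) (G : groupType) (X : metricType R) (act : G -> X -> X).
Variables (F : nat -> {fset G}) (U : {fset set X}) (eta : R).
Hypotheses (actG : group_action act) (openU : open_cover U) (eta0 : 0 < eta).
Local Notation card A := (#|` A|%fset%:R : R).

Lemma bowen_ballP (A : {fset G}) x y : bowen_ball act A eta x y <->
  {in A, forall g, mdist (act g x) (act g y) <= eta}.
Proof.
split=> [/= le_eta g gA|le_eta].
  apply: le_trans le_eta; rewrite /bowen_dist.
  exact: (@le_bigmax_seq _ _ _ _ 0 g xpredT (fun g => mdist (act g x) (act g y))).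
rewrite /bowen_ball /bowen_dist /= big_seq.
by apply: bigmax_le => [|g]; [exact: ltW|exact: le_eta].
Qed.

Lemma subset_bowen_ball (A B : {fset G}) x :
  (A `<=` B)%fset -> bowen_ball act B eta x `<=` bowen_ball act A eta x.
Proof.
by move=> AB y /bowen_ballP le_eta; apply/bowen_ballP => g /(fsubsetP AB)/le_eta.
Qed.

Lemma join_cover_nbhs (A : {fset G}) (B : set X) x :
  join_cover act U A B -> B x -> nbhs x B.
Proof.
move=> [c [cU ->]] Bx; apply: filter_bigI => g gA.
apply: (act_continuous actG); apply: open_nbhs_nbhs; split; last exact: Bx.
by apply: (proj1 openU); exact: cU.
Qed.

(* A point outside Gamma is separated from x by a single g, and stays so when
   both points are perturbed. *)
Lemma compact_bowen_ball (I : set nat) (B : nat -> set X) x :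
  compact [set: X] ->
  (forall i, I i -> forall y, B i y -> nbhs y (B i)) ->
  Gamma act eta x `<=` \bigcup_(i in I) B i ->
  exists (A : {fset G}) (J : {fset nat}), [set` J] `<=` I /\
    \forall z \near x, bowen_ball act A eta z `<=` \bigcup_(i in [set` J]) B i.
Proof.
move=> cX Bnbhs cov.
(* Localizing to [W] lets each piece have its own window and finite subfamily; a union of two pieces
   takes the unions of both. *)
pose P W := exists (A : {fset G}) (J : {fset nat}), [set` J] `<=` I /\
    \forall z \near x, bowen_ball act A eta z `&` W `<=` \bigcup_(i in [set` J]) B i.
suff [A [J [JI H]]] : P [set: X].
  by exists A, J; split => //; apply: filterS H => z; rewrite setIT.
apply: compact_set_ind => //.
- by exists fset0, fset0; split => //; apply: nearW => z; rewrite setI0.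
- move=> V W VW [A [J [JI H]]]; exists A, J; split => //.
  by apply: filterS H => z; apply: subset_trans; exact: setIS.
- move=> V W [A [J [JI HV]]] [A' [J' [JI' HW]]].
  exists (A `|` A')%fset, (J `|` J')%fset; split.
    by move=> i /=; rewrite inE => /orP[/JI|/JI'].
  apply: filterS2 HV HW => z HV HW y [Ay [Vy|Wy]].
    have [|i iJ Biy] := HV y.
      by split => //; apply: subset_bowen_ball Ay; exact: fsubsetUl.
    by exists i => //=; rewrite inE; apply/orP; left.
  have [|i iJ Biy] := HW y.
    by split => //; apply: subset_bowen_ball Ay; exact: fsubsetUr.
  by exists i => //=; rewrite inE; apply/orP; right.
have acont g : continuous (act g) by case: actG.
move=> y; have [xy|] := pselect (Gamma act eta x y).
  have [i Ii Biy] := cov y xy; exists (B i); first exact: Bnbhs.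
  exists fset0, [fset i]%fset; split; first by move=> j /=; rewrite inE => /eqP ->.
  by apply: nearW => z w [_ Bw]; exists i => //=; rewrite inE.
move=> /existsNP[g /negP]; rewrite -ltNge => far.
(* Half the excess over [eta]: with [x] and [y] each moved by less than [r] in the [g] direction,
   the triangle inequality keeps the distance above [eta]. *)
pose r := (mdist (act g x) (act g y) - eta) / 2.
have r0 : 0 < r by rewrite divr_gt0// subr_gt0.
exists [set w | mdist (act g y) (act g w) < r].
  exact: (metricType_numDomainType.cvgr_dist_lt (acont g y) r0).
exists [fset g]%fset, fset0; split => //.
have near_x : \forall z \near x, mdist (act g x) (act g z) < r.
  exact: (metricType_numDomainType.cvgr_dist_lt (acont g x) r0).
apply: filterS near_x => z zr w [/bowen_ballP/(_ g)]; rewrite inE eqxx => /(_ isT) zw yw.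
exfalso; have := metric_triangle (act g x) (act g z) (act g y).
have := metric_triangle (act g z) (act g w) (act g y).
rewrite [mdist (act g w) _]metric_sym; move: zr zw yw; rewrite /= /r; lra.
Qed.

(** A smaller [eps] admits fewer covers, so the limit at 0 is the supremum over positive [eps]. *)
Lemma dim_premeasure_eps_le0 (Z : set X) (l eps : R) : 0 < eps ->
  dim_premeasure act U Z F l = 0%E ->
  (dim_premeasure_eps act U Z F l eps <= 0)%E.
Proof.
move=> eps0 <-; rewrite /dim_premeasure.
have cvgp := @nonincreasing_at_right_cvge R
  (dim_premeasure_eps act U Z F l) 0 +oo%O erefl.
rewrite (cvg_lim (@ereal_hausdorff R) (cvgp _)).
  by apply: ereal_sup_ubound; exists eps => //=; rewrite in_itv /= eps0.
move=> e1 e2; rewrite !in_itv /= !andbT => e10 e20 e12.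
apply: le_ereal_inf => s [I [B [m [Im cov ->]]]]; exists I, B, m; split => // i Ii.
have [m0 le_m Bi] := Im i Ii; split => //; apply: le_trans le_m.
by rewrite lef_pV2.
Qed.

(** An option is an index together with a labelling of that Følner set by members of [U], that is, a
    cylinder. Requiring the Følner set inside the window [A] places the tile in any set containing
    [A g]. *)
Definition covering_options (lam : R) N (s : R) (A : {fset G}) z
    (O : seq (nat * (G -> set X))) :=
  [/\ {in O, forall o, [/\ (N <= o.1)%N, (0 < o.1)%N, (F o.1 `<=` A)%fset
          & {in F o.1, forall g, o.2 g \in U}]},
      \sum_(o <- O) expR (- (lam * card (F o.1))) <= s
    & forall y, bowen_ball act A eta z y ->
        exists2 o, o \in O & {in F o.1, forall g, o.2 g (act g y)}].

Lemma local_covering_options (lam l s : R) N x :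
  compact [set: X] -> l <= lam -> 0 < s ->
  dim_premeasure act U (Gamma act eta x) F l = 0%E ->
  exists A O, \forall z \near x, covering_options lam N s A z O.
Proof.
move=> cX llam s0 dim0.
(* [eps^-1] exceeds the size of every [F k] with [k < N], so the size condition on a cover forces
   its indices to be at least [N]. *)
pose eps : R := (1 + \sum_(k < N) card (F k))^-1.
have eps0 : 0 < eps by rewrite invr_gt0 ltr_pwDl// sumr_ge0.
have := dim_premeasure_eps_le0 eps0 dim0.
move=> /le_lt_trans/(_ (_ : 0 < s%:E)%E); rewrite lte_fin => /(_ s0).
move=> /ereal_inf_lt[_ [I [B [m [Im cov ->]]]] lts].
have [|A [J [JI near_x]]] := @compact_bowen_ball I B x cX _ cov.
  by move=> i Ii y; have [_ _] := Im i Ii; exact: join_cover_nbhs.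
have /choice[c cP] : forall i, exists c : G -> set X, I i ->
    (forall g, g \in F (m i) -> c g \in U) /\
    B i = \bigcap_(g in [set` F (m i)]) (act g @^-1` c g).
  move=> i; have [Ii|?] := pselect (I i); last by exists (fun=> set0).
  by have [_ _ [c cP]] := Im i Ii; exists c.
exists (A `|` \bigcup_(i <- J) F (m i))%fset, [seq (m i, c i) | i <- J].
apply: filterS near_x => z Jz; split.
- move=> _ /mapP[i iJ ->] /=; have [m0 le_m _] := Im i (JI i iJ); split => //.
  + rewrite leqNgt; apply/negP => miN; move: le_m; rewrite invrK.
    rewrite (bigD1 (Ordinal miN))//= => /le_gtF/negP; apply.
    by rewrite addrCA ltrDl ltr_pwDl// sumr_ge0.
  + apply: fsubset_trans (fsubsetUr _ _); exact: bigfcup_sup.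
  + by have [cU _] := cP i (JI i iJ).
- rewrite big_map -lee_fin ltW// (le_lt_trans _ lts)//.
  apply: esum_ge; exists [set` J]; first by split.
  rewrite fsbig_finite//= set_fsetK -sumEFin; apply: lee_sum => i _.
  by rewrite lee_fin ler_expR lerN2 ler_wpM2r.
- move=> y /(subset_bowen_ball (fsubsetUl _ _))/Jz[i /= iJ].
  have [_ ->] := cP i (JI i iJ) => By.
  by exists (m i, c i); [exact: map_f|move=> g; exact: By].
Qed.

(** Options remain valid when the window grows, so the local windows merge into one by
    compactness. *)
Lemma uniform_covering_options (lam s : R) N :
  compact [set: X] -> 0 < s ->
  (forall x, exists2 l, l <= lam &
    dim_premeasure act U (Gamma act eta x) F l = 0%E) ->
  exists A, forall z, exists O, covering_options lam N s A z O.
Proof.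
move=> cX s0 dim0.
pose P V := exists A, forall z, V z -> exists O, covering_options lam N s A z O.
suff [A H] : P [set: X] by exists A => z; exact: H.
have mono A A' z O : (A `<=` A')%fset -> covering_options lam N s A z O ->
    covering_options lam N s A' z O.
  move=> AA' [Oin Osum Ocov]; split => // [t /Oin[? ? ? ?]|y].
    by split => //; exact: fsubset_trans AA'.
  by move=> /(subset_bowen_ball AA')/Ocov.
apply: compact_set_ind => //.
- by exists fset0.
- by move=> V W VW [A H]; exists A => z /VW/H.
- move=> V W [A HV] [A' HW]; exists (A `|` A')%fset => z [/HV|/HW] [Q ?].
    by exists Q; apply: mono; first exact: fsubsetUl.
  by exists Q; apply: mono; first exact: fsubsetUr.
move=> x; have [l llam dimx] := dim0 x.
have [A [Q H]] := local_covering_options N cX llam s0 dimx.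
by exists [set z | covering_options lam N s A z Q] => //; exists A => z ?; exists Q.
Qed.

End Dynamics.

(** * Covering a Bowen ball through coded tilings *)

Lemma ler_sum_uniq_mem (R : realType) (I : eqType) (r s : seq I) (h : I -> R) :
  (forall i, 0 <= h i) -> uniq r -> uniq s ->
  \sum_(i <- r | i \in s) h i <= \sum_(i <- s) h i.
Proof.
move=> h0 ur us; rewrite -big_filter.
rewrite (@perm_big _ _ _ _ _ [seq i <- s | i \in r]); last first.
  apply: uniq_perm; rewrite ?filter_uniq// => i.
  by rewrite !mem_filter andbC.
rewrite big_filter big_mkcond; apply: ler_sum => i _.
by case: ifP.
Qed.

Section CoverNumber.
Context (R : realType) (G : groupType) (X : metricType R) (act : G -> X -> X).
Variables (F : nat -> {fset G}) (U : {fset set X}) (eta C : R).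
Hypotheses (actG : group_action act) (openU : open_cover U) (eta0 : 0 < eta).
Local Notation card A := (#|` A|%fset%:R : R).

(** Each [g] in [E] lies in a tile recorded by the code, and that tile's label at [g] contains
    [act g y] for every [y] with this code; the labels together give one element of the join. *)
Lemma cover_number_tilings (P : eqType) (T : choiceType) (O : P -> seq T)
    (w : T -> R) (ctr : P -> G) (shape : T -> {fset G}) (lab : T -> G -> set X)
    (E : {fset G}) (K : set X) (sigma : X -> P -> option T) (ps : seq P) (b : R) :
  (forall y p t, K y -> sigma y p = Some t -> t \in O p /\
     {in shape t, forall k, lab t k \in U /\ lab t k (act (k * ctr p)%g y)}) ->
  (forall y, K y -> \sum_(p <- ps) oapp w 0 (sigma y p) <= b) ->
  (forall y g, K y -> g \in E -> exists p t,
     [/\ p \in ps, sigma y p = Some t & g \in rtrans (shape t) (ctr p)]) ->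
  (cover_number (join_cover act U E) K <=
    (expR b * \prod_(p <- ps) (1 + \sum_(t <- O p) expR (- w t)))%:E)%E.
Proof.
move=> valid cost_le cov; apply: (cover_number_codes _ cost_le).
  by move=> y p t Ky /(valid y p t Ky)[].
move=> y0 Ky0.
have /choice[c cP] : forall g, exists V : set X, g \in E -> V \in U /\
    forall y, K y -> map (sigma y) ps = map (sigma y0) ps -> V (act g y).
  move=> g; have [gE|?] := boolP (g \in E); last by exists set0.
  have [p [t [pps st]]] := cov y0 g Ky0 gE; rewrite in_rtrans => gt.
  exists (lab t (g * (ctr p)^-1)%g) => _; split.
    by have [_ /(_ _ gt)[]] := valid y0 p t Ky0 st.
  move=> y Ky /eq_in_map yy0; have syt : sigma y p = Some t by rewrite yy0.
  have [_ /(_ _ gt)[_]] := valid y p t Ky syt.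
  by rewrite mulgVK.
exists (\bigcap_(g in [set` E]) (act g @^-1` c g)); split.
  by exists c; split => // g /cP[].
by move=> y Ky yy0 g /cP[_]; exact.
Qed.

Hypothesis F1 : forall n, (0 < n)%N -> 1%g \in F n.
Hypothesis C0 : 0 <= C.
Hypothesis temp : forall n, (0 < n)%N ->
  card (\bigcup_(k <- index_iota 1 n) invmul_fset (F k) (F n)) <= C * card (F n).

(* An uncovered g in F n is coded by a member of U containing g y, i.e. by a
   tile of shape {1}; index 0, at which F is irrelevant, marks these tiles. *)
Lemma cover_number_bowen_ball (lam s gam eps theta : R) (L : nat)
    (A : nat -> {fset G}) (N : nat -> nat) (E : {fset G}) (x : X) :
  let q := 1 - (1 - eps) / (C + eps^-1) in
  0 < eps <= 2^-1 -> 0 <= gam -> 0 <= lam -> 0 <= theta ->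
  (forall l, (l < L)%N -> almost_invariant gam (A l) E) ->
  (forall l z, (l < L)%N -> exists O,
     covering_options act F U eta lam (N l) s (A l) z O) ->
  (forall l m k, (l < L)%N -> (N l <= m)%N -> (0 < m)%N -> (k < l)%N ->
     almost_invariant gam (A k) (F m)) ->
  (cover_number (join_cover act U E) (bowen_ball act E eta x) <=
    (expR ((lam / (1 - eps) + theta * (q ^+ L + 3 * gam) + L%:R * s +
            card U * expR (- theta)) * card E))%:E)%E.
Proof.
move=> q epsP gam0 lam0 theta0 invE options invF.
have /choice[Opt OptP] : forall lz : nat * X, exists O, (lz.1 < L)%N ->
    covering_options act F U eta lam (N lz.1) s (A lz.1) lz.2 O.
  move=> [l z]; have [lL|?] := boolP (l < L)%N; last by exists [::].
  by have [Q QP] := options l z lL; exists Q.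
pose T := (nat * (G -> set X))%type : choiceType.
pose inside l g := {in A l, forall a, (a * g)%g \in E}.
pose K := bowen_ball act E eta x.
(* [opt] picks a cylinder for [g x] that contains [g y]; one exists because [A l g] inside [E] puts
   [g y] in the Bowen ball of [A l] around [g x]. *)
have /choice[opt optP] : forall ylg : X * (nat * G), exists t : T,
    K ylg.1 -> (ylg.2.1 < L)%N -> inside ylg.2.1 ylg.2.2 ->
    t \in Opt (ylg.2.1, act ylg.2.2 x) /\
    {in F t.1, forall k, t.2 k (act (k * ylg.2.2)%g ylg.1)}.
  move=> [y [l g]] /=.
  have [[Ky lL lg]|no] := pselect [/\ K y, (l < L)%N & inside l g]; last first.
    by exists (0%N, fun=> set0) => ? ? ?; exfalso; apply: no.
  have [_ _ cov] := OptP (l, act g x) lL.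
  have [|t tO tP] := cov (act g y).
    apply/bowen_ballP => // a aA; rewrite -!(act_mul actG).
    by move/(bowen_ballP _ eta0) : Ky; apply; exact: lg.
  by exists t => _ _ _; split => // k kF; rewrite (act_mul actG); exact: tP.
have /choice[cov covP] : forall z : X, exists V, V \in U /\ V z.
  by move=> z; have [V VU Vz] := proj2 openU z I; exists V.
have tiling y : K y -> exists sel : seq (nat * G),
    let S := (\bigcup_(p <- sel) rtrans (F (opt (y, p)).1) p.2)%fset in
    [/\ uniq sel, {in sel, forall p, (p.1 < L)%N /\ inside p.1 p.2},
        (1 - eps) * (\sum_(p <- sel) card (F (opt (y, p)).1)) <= card E
      & card (E `\` S) <= (q ^+ L + 3 * gam) * card E].
  move=> Ky; have [|sel /= [us selP selS selT]] :=
    @multilayer_tiling R G F C temp eps gam L A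
      (fun l g => (opt (y, (l, g))).1) E epsP gam0 C0 invE _ L (leqnn L).
    move=> l g lL lg; have /= [tO _] := optP (y, (l, g)) Ky lL lg.
    have [/(_ _ tO)[Nt t0 FA _] _ _] := OptP (l, act g x) lL.
    by split => //; [by apply/fset0Pn; exists 1%g; exact: F1|move=> k; exact: invF].
  have eS : (\bigcup_(p <- sel) rtrans (F (opt (y, (p.1, p.2))).1) p.2 =
      \bigcup_(p <- sel) rtrans (F (opt (y, p)).1) p.2)%fset.
    by apply: eq_bigr => -[].
  have eF : \sum_(p <- sel) card (F (opt (y, (p.1, p.2))).1) =
      \sum_(p <- sel) card (F (opt (y, p)).1).
    by apply: eq_bigr => -[].
  rewrite eS eF in selS selT.
  exists sel; split => // [p /selP[]//|].
  apply: le_trans selS _; rewrite ler_nat; apply: fsubset_leq_card.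
  apply/bigfcupsP => -[l g] /selP[_ lL lg] _.
  have /= [tO _] := optP (y, (l, g)) Ky lL lg.
  have [/(_ _ tO)[_ _ /fsubsetP FA _] _ _] := OptP (l, act g x) lL.
  by apply/fsubsetP => h; rewrite in_rtrans => /FA/lg; rewrite mulgVK.
have /choice[sel selP] : forall y, exists sel : seq (nat * G), K y ->
    let S := (\bigcup_(p <- sel) rtrans (F (opt (y, p)).1) p.2)%fset in
    [/\ uniq sel, {in sel, forall p, (p.1 < L)%N /\ inside p.1 p.2},
        (1 - eps) * (\sum_(p <- sel) card (F (opt (y, p)).1)) <= card E
      & card (E `\` S) <= (q ^+ L + 3 * gam) * card E].
  move=> y; have [/tiling[r rP]|?] := pselect (K y); last by exists [::].
  by exists r.
pose rest y :=
  (E `\` \bigcup_(p <- sel y) rtrans (F (opt (y, p)).1) p.2)%fset.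
pose point y g : T := (0%N, fun=> cov (act g y)).
pose sigma y (p : nat * G) : option T :=
  if (p.1 < L)%N then if p \in sel y then Some (opt (y, p)) else None
  else if p.2 \in rest y then Some (point y p.2) else None.
pose shape (t : T) := if t.1 == 0%N then [fset 1%g]%fset else F t.1.
pose w (t : T) := if t.1 == 0%N then theta else lam * card (F t.1).
pose O (p : nat * G) : seq T := if (p.1 < L)%N then Opt (p.1, act p.2 x)
  else [seq (0%N, fun=> V) | V <- U].
(* Layers below [L] carry tiles, and the additional layer [L] carries the uncovered points. *)
pose ps := [seq (l, g) | l <- index_iota 0 L.+1, g <- E].
have ups : uniq ps.
  apply: allpairs_uniq; [exact: iota_uniq|exact: fset_uniq|].
  by move=> [? ?] [? ?] _ _ [-> ->].
have t_gt0 y p : K y -> p \in sel y -> (0 < (opt (y, p)).1)%N.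
  case: p => l g Ky pS; have [_ /(_ _ pS)[/= lL lg] _ _] := selP y Ky.
  have [/= tO _] := optP (y, (l, g)) Ky lL lg.
  by have [/(_ _ tO)[]] := OptP (l, act g x) lL.
(* Selected tiles have total size at most [card E / (1 - eps)] and cost [lam] per point; uncovered
   points cost [theta] each. *)
pose b := (lam / (1 - eps) + theta * (q ^+ L + 3 * gam)) * card E.
have valid y p t : K y -> sigma y p = Some t -> t \in O p /\
    {in shape t, forall k, t.2 k \in U /\ t.2 k (act (k * p.2)%g y)}.
  case: p => l g Ky; rewrite /sigma /O /=.
  case: ifP => lL; case: ifP => // pS [<-]; last first.
    have [VU Vgy] := covP (act g y); split; first exact: map_f.
    by move=> k; rewrite /shape /= inE => /eqP ->; rewrite mul1g.
  have [_ /(_ _ pS)[/= _ lg] _ _] := selP y Ky.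
  have [/= tO tP] := optP (y, (l, g)) Ky lL lg; split => // k.
  have := t_gt0 _ _ Ky pS; rewrite /shape lt0n => /negbTE -> kF.
  have [/(_ _ tO)[_ _ _ inU] _ _] := OptP (l, act g x) lL.
  by split; [exact: inU|exact: tP].
have cost_le y : K y -> \sum_(p <- ps) oapp w 0 (sigma y p) <= b.
  move=> Ky; have [us selin selS selT] := selP y Ky.
  pose h p := lam * card (F (opt (y, p)).1).
  pose restL := [seq (L, g) | g <- rest y].
  apply: (@le_trans _ _ (\sum_(p <- ps) ((if p \in sel y then h p else 0) +
      (if p \in restL then theta else 0)))).
    rewrite big_seq [leRHS]big_seq; apply: ler_sum => -[l g].
    move=> /allpairsP[[l' g'] /= [lps gE [-> ->]]] {l g}.
    move: lps; rewrite mem_index_iota /= => lL; rewrite /sigma /=.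
    have h0 p : 0 <= h p by rewrite mulr_ge0.
    case: ifP => [lL'|/negbT].
      case: ifP => pS /=; last by rewrite add0r; case: ifP.
      have := t_gt0 _ _ Ky pS; rewrite /w lt0n => /negbTE ->.
      by rewrite lerDl; case: ifP.
    rewrite -leqNgt => Ll; have {Ll lL} -> : l' = L.
      by apply/eqP; rewrite eqn_leq Ll -ltnS lL.
    case: ifP => gr /=; last by rewrite addr_ge0//; case: ifP.
    by rewrite map_f// lerDr; case: ifP.
  rewrite big_split /= -!big_mkcond /b mulrDl; apply: lerD.
    apply: le_trans (ler_sum_uniq_mem _ ups us) _.
      by move=> p; rewrite mulr_ge0.
    rewrite -mulr_sumr mulrAC -mulrA ler_wpM2l// ler_pdivlMr; last first.
      by move: epsP => /andP[_ ?]; rewrite subr_gt0; lra.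
    by rewrite mulrC.
  apply: le_trans (ler_sum_uniq_mem _ ups _) _ => //.
    by rewrite map_inj_uniq ?fset_uniq// => g g' [].
  rewrite big_map big_const_seq count_predT iter_addr_0 -[leLHS]mulr_natr -mulrA.
  by rewrite ler_wpM2l.
have covers y g : K y -> g \in E -> exists p t,
    [/\ p \in ps, sigma y p = Some t & g \in rtrans (shape t) p.2].
  move=> Ky gE; have [gr|] := boolP (g \in rest y).
    exists (L, g), (point y g); split.
    - by apply/allpairsP; exists (L, g); rewrite mem_index_iota /=.
    - by rewrite /sigma /= ltnn gr.
    - by rewrite in_rtrans mulgV /shape /= inE.
  rewrite inE gE andbT negbK => /bigfcupP[p /andP[pS _] gp].
  have [_ /(_ _ pS)[pL pin] _ _] := selP y Ky.
  exists p, (opt (y, p)); split; last 2 first.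
  - by rewrite /sigma pL pS.
  - by rewrite /shape -[_ == _]negbK -lt0n (t_gt0 _ _ Ky pS).
  apply/allpairsP; exists p; rewrite mem_index_iota /= ltnS (ltnW pL) -surjective_pairing.
  (* The center lies in [E] because the identity belongs to the tile's Følner set, hence to the
     window. *)
  split => //; rewrite -[p.2]mul1g; apply: pin.
  have [_ /(_ _ pS)[/= lL lg] _ _] := selP y Ky.
  have [tO _] := optP (y, p) Ky lL lg.
  have [/(_ _ tO)[_ ? /fsubsetP FA _] _ _] := OptP (p.1, act p.2 x) lL.
  by apply: FA; exact: F1.
apply: le_trans (cover_number_tilings valid cost_le covers) _.
rewrite lee_fin; pose a (p : nat * G) : R := if (p.1 < L)%N then s else card U * expR (- theta).
(* By [1 + x <= expR x], a tile position contributes at most [s] to the exponent and a position of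
   layer [L] at most [card U * expR (- theta)]. *)
have prod_le : \prod_(p <- ps) (1 + \sum_(t <- O p) expR (- w t)) <=
    expR (\sum_(p <- ps) a p).
  rewrite expR_sum; apply: ler_prod => -[l g] _.
  rewrite addr_ge0//= ?sumr_ge0//.
  apply: le_trans (expR_ge1Dx _) _; rewrite ler_expR /O /a /=.
  case: ifP => lL; last first.
    rewrite big_map /w /= big_const_seq count_predT iter_addr_0.
    by rewrite mulr_natl.
  have [Oin Osum _] := OptP (l, act g x) lL; apply: le_trans Osum.
  rewrite big_seq [leRHS]big_seq; apply: ler_sum => t /Oin[_ t0 _ _].
  by rewrite /w -[_ == _]negbK -lt0n t0.
apply: le_trans (ler_wpM2l (expR_ge0 b) prod_le) _.
rewrite -expRD ler_expR /b -addrA [leRHS]mulrDl lerD2l.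
have -> : \sum_(p <- ps) a p = card E *
    (\sum_(0 <= l < L.+1) if (l < L)%N then s else card U * expR (- theta)).
  rewrite [LHS]big_allpairs_dep mulr_sumr; apply: eq_bigr => l _.
  by rewrite /a /= big_const_seq count_predT iter_addr_0 [RHS]mulr_natl.
rewrite [leLHS]mulrC ler_wpM2r// big_nat_recr//= ltnn lerD2r.
rewrite (eq_big_nat _ _ (F2 := fun=> s)) => [|l /andP[_ ->]//].
by rewrite sumr_const_nat subn0 mulr_natl.
Qed.

End CoverNumber.

(* Each layer uses only indices so large that its tiles are almost invariant
   under the sets controlling all previous layers. *)
Lemma nested_layers (G : groupType) (P : nat -> {fset G} -> Prop)
    (inv : {fset G} -> nat -> Prop) :
  (forall A A' m, (A' `<=` A)%fset -> inv A m -> inv A' m) ->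
  (forall N, exists A, P N A) ->
  (forall A, exists N, forall m, (N <= m)%N -> (0 < m)%N -> inv A m) ->
  exists A N, forall l, P (N l) (A l) /\
    forall m k, (N l <= m)%N -> (0 < m)%N -> (k < l)%N -> inv (A k) m.
Proof.
move=> invW /choice[f fP] /choice[g gP].
(* [B l] collects the windows of all layers below [l], and [g (B l)] is the index threshold for
   layer [l]. *)
pose B := fix B l := if l is l'.+1 then (B l' `|` f (g (B l')))%fset else fset0.
exists (fun l => f (g (B l))), (fun l => g (B l)) => l; split => // m k Nm m0 kl.
apply: invW (gP _ m Nm m0); elim: l kl {Nm} => // l IH.
rewrite ltnS leq_eqVlt => /predU1P[->|/IH kl]; first exact: fsubsetUr.
exact: fsubset_trans kl (fsubsetUl _ _).
Qed.

(** * Choice of constants and the uniform bound *)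

Section CoverNumberBound.
Context (R : realType) (G : groupType) (X : metricType R) (act : G -> X -> X).
Variables (F : nat -> {fset G}) (U : {fset set X}) (eta C : R).

Lemma hdim_ge0 (Z : set X) : (0 <= hdim act Z U F)%E.
Proof. by apply: le_ereal_inf_tmp => _ [l [l0 _] <-]; rewrite lee_fin ltW. Qed.

Lemma hdim_lt (Z : set X) (l : R) : (hdim act Z U F < l%:E)%E ->
  exists2 l', l' <= l & dim_premeasure act U Z F l' = 0%E.
Proof.
move=> /ereal_inf_lt[_ [l' [_ dim0] <-]]; rewrite lte_fin => /ltW l'l.
by exists l'.
Qed.

Lemma exists_expr_le (q e : R) : 0 <= q < 1 -> 0 < e -> exists L, q ^+ L <= e.
Proof.
move=> /andP[q0 q1] e0.
have /cvgrPdist_lt/(_ _ e0)[L _ /(_ L (leqnn L))] : q ^+ n @[n --> \oo] --> (0 : R).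
  by apply: cvg_expr; rewrite ger0_norm.
by rewrite /= sub0r normrN ger0_norm ?exprn_ge0// => /ltW; exists L.
Qed.

Lemma cover_number_bowen_ball_le (lam lam' : R) :
  compact [set: X] -> group_action act -> folner R F -> tempered C F ->
  (forall n, (0 < n)%N -> 1%g \in F n) -> open_cover U -> 0 < eta ->
  0 <= lam' < lam ->
  (forall x, (hdim act (Gamma act eta x) U F < lam'%:E)%E) ->
  exists P : nat, forall n x, (P < n)%N ->
    (cover_number (join_cover act U (F n)) (bowen_ball act (F n) eta x) <=
      (expR (lam * #|` F n|%:R))%:E)%E.
Proof.
move=> cX actG folF [C0 tempF] F1 openU eta0 /andP[lam0 lam_lt] hdimP.
have temp n : (0 < n)%N ->
    #|` (\bigcup_(k <- index_iota 1 n) invmul_fset (F k) (F n))%fset|%:R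
      <= C * #|` F n|%:R.
  (* At [n = 1] the union is empty. *)
  case: n => [//|[_|n _]]; last exact: tempF.
  by rewrite /index_iota big_nil cardfs0 mulr_ge0// ltW.
(* Each of four errors gets a quarter of the gap: overlap of tiles, cost of uncovered points, choice
   of cylinders, choice of labels at uncovered points. *)
pose kap := (lam - lam') / 4.
have kap0 : 0 < kap by rewrite divr_gt0// subr_gt0.
(* With this value [(lam' + kap) (1 - eps) = lam' + kap / 2], which is at least [lam']. *)
pose eps := kap / (2 * (lam' + kap)).
have den0 : 0 < lam' + kap by rewrite ltr_wpDl.
have eps0 : 0 < eps by rewrite divr_gt0// mulr_gt0.
have eps2 : eps <= 2^-1.
  by rewrite ler_pdivrMr ?mulr_gt0// mulKf// lerDr.
have eps1 : eps < 1 by apply: le_lt_trans eps2 _; rewrite invf_lt1// ltr1n.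
have le1 : lam' / (1 - eps) <= lam' + kap.
  rewrite ler_pdivrMr ?subr_gt0//.
  have : eps * (lam' + kap) = kap / 2 by rewrite /eps; field; rewrite gt_eqF.
  lra.
(* Since [expR theta] is at least [1 + theta], this makes [|U| expR (- theta)] at most [kap]. *)
pose theta := #|` U|%:R / kap.
have theta0 : 0 <= theta by rewrite divr_ge0// ltW.
have le4 : #|` U|%:R * expR (- theta) <= kap.
  rewrite expRN ler_pdivrMr ?expR_gt0//.
  apply: le_trans (ler_wpM2l (ltW kap0) (expR_ge1Dx theta)).
  by rewrite mulrDr mulr1 /theta mulrCA divff ?gt_eqF// mulr1 lerDr ltW.
(* [rho] bounds the uncovered proportion; [q ^+ L] and [3 * gam] receive half of it each. *)
pose rho := kap / (theta + 1).
have rho0 : 0 < rho by rewrite divr_gt0// ltr_wpDl.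
have le2 : theta * rho <= kap.
  rewrite /rho mulrCA; apply: ler_piMr; first exact: ltW.
  by rewrite ler_pdivrMr ?ltr_wpDl// mul1r lerDl.
pose q := 1 - (1 - eps) / (C + eps^-1).
have Ceps : 0 < C + eps^-1 by rewrite addr_gt0// invr_gt0.
have q01 : 0 <= q < 1.
  rewrite subr_ge0 ler_pdivrMr// mul1r gtrBl divr_gt0 ?subr_gt0// andbT.
  have : 1 <= eps^-1 by rewrite invf_ge1// ltW.
  by move: C0 eps0; lra.
have [L qL] := exists_expr_le q01 (divr_gt0 rho0 (ltr0n R 2)).
pose gam := rho / 6.
have gam0 : 0 < gam by rewrite divr_gt0.
pose s := kap / L.+1%:R.
have s0 : 0 < s by rewrite divr_gt0// ltr0n.
have le3 : L%:R * s <= kap.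
  rewrite /s mulrCA; apply: ler_piMr; first exact: ltW.
  by rewrite ler_pdivrMr ?ltr0n// mul1r ler_nat.
have [A [N layers]] := @nested_layers G
  (fun N A => forall z, exists O, covering_options act F U eta lam' N s A z O)
  (fun A m => almost_invariant gam A (F m))
  (fun A A' m => @almost_invariantW R G gam A A' (F m))
  (fun N => uniform_covering_options actG openU eta0 N cX s0
     (fun x => hdim_lt (hdimP x)))
  (fun A => folner_almost_invariant A folF gam0).
(* Almost invariance under the union of the first [L] windows gives it for each of them. *)
have [P PE] := folner_almost_invariant (\bigcup_(l <- iota 0 L) A l)%fset folF gam0.
exists P => n x Pn; have n0 : (0 < n)%N := leq_ltn_trans (leq0n P) Pn.
have eps02 : 0 < eps <= 2^-1 by rewrite eps0.
apply: le_trans (@cover_number_bowen_ball _ _ _ act F U eta C actG openU eta0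
  F1 (ltW C0) temp lam' s gam eps theta L A N (F n) x eps02 (ltW gam0) lam0 theta0
  _ _ _) _.
- move=> l lL; apply: almost_invariantW (PE n (ltnW Pn) n0).
  by apply: bigfcup_sup; rewrite // mem_iota.
- by move=> l z _; have [] := layers l.
- by move=> l m k _; have [_] := layers l; exact.
rewrite lee_fin ler_expR ler_wpM2r// -/q.
have : theta * (q ^+ L + 3 * gam) <= theta * rho.
  by rewrite ler_wpM2l// /gam; move: qL; lra.
by move: le1 le2 le3 le4; rewrite /kap; lra.
Qed.

End CoverNumberBound.

(** * From the exponential bound to the stated inequality *)

Theorem proposition4p1 (R : realType) (G : groupType) (X : metricType R)
    (act : G -> X -> X) (F : nat -> {fset G}) (C : R)
    (U : {fset set X}) (eta lambda : R) :
  ([set: G] #= [set: nat])%card ->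
  amenable R G ->
  [set: X] !=set0 ->
  compact [set: X] ->
  group_action act ->
  folner R F ->
  tempered C F ->
  #|` F n|%:R / ln (n%:R : R) @[n --> \oo] --> +oo ->
  (forall n, (0 < n)%N -> 1%g \in F n) ->
  open_cover U ->
  0 < eta ->
  (ereal_sup (range (fun x => hdim act (Gamma act eta x) U F)) < lambda%:E)%E ->
  exists delta0 : R, 0 < delta0 /\
    forall delta : R, 0 < delta < delta0 ->
      exists P : nat, forall n : nat, (P < n)%N ->
        (ereal_sup (range (fun x =>
             cover_number (join_cover act U (F n)) (bowen_ball act (F n) eta x)))
         <= ((#|` U|%:R `^ ((delta + delta `^ (4^-1)) * #|` F n|%:R))
             * expR (lambda * #|` F n|%:R)
             * (2 `^ (delta * #|` F n|%:R)))%:E)%E.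
Proof.
move=> _ _ [x0 _] cX actG folF tempF _ F1 openU eta0.
set v := ereal_sup _ => v_lt.
have hdim_le x : (hdim act (Gamma act eta x) U F <= v)%E.
  by apply: ereal_sup_ubound; exists x.
have v0 : (0 <= v)%E := le_trans (hdim_ge0 _ _ _ _) (hdim_le x0).
have vE : v = (fine v)%:E.
  by rewrite fineK// ge0_fin_numE// (lt_trans v_lt)// ltry.
have fv0 : 0 <= fine v by rewrite fine_ge0.
have fv_lt : fine v < lambda by rewrite -lte_fin -vE.
(* The supremum is finite, lying between 0 and [lambda], so the midpoint strictly separates it from
   [lambda]. *)
pose lam' := (fine v + lambda) / 2.
have lam'P : 0 <= lam' < lambda by rewrite /lam'; apply/andP; split; lra.
have hdimP x : (hdim act (Gamma act eta x) U F < lam'%:E)%E.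
  by apply: le_lt_trans (hdim_le x) _; rewrite vE lte_fin /lam'; lra.
have [P cover_le] :=
  cover_number_bowen_ball_le cX actG folF tempF F1 openU eta0 lam'P hdimP.
exists 1; split => // delta /andP[delta0 _]; exists P => n Pn.
apply: ge_ereal_sup => _ [x _ <-]; apply: le_trans (cover_le n x Pn) _.
(* For positive [delta] the two other factors are powers, with nonnegative exponents, of bases at
   least 1; [U] is nonempty because it covers [x0]. *)
have U1 : 1 <= #|` U|%:R :> R.
  rewrite ler1n cardfs_gt0; apply/fset0Pn.
  by have [V VU _] := proj2 openU x0 I; exists V.
have ge1 (a r : R) : 1 <= a -> 0 <= r -> 1 <= a `^ r.
  move=> a1 r0; apply: (@le_trans _ _ (1 `^ r)); first by rewrite powR1.
  by rewrite ge0_ler_powR// nnegrE (le_trans ler01).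
rewrite lee_fin; apply: (@le_trans _ _ (1 * expR (lambda * #|` F n|%:R) * 1)).
  by rewrite mul1r mulr1.
apply: ler_pM; rewrite ?mulr_ge0 ?expR_ge0//.
  by rewrite ler_wpM2r ?expR_ge0// ge1// mulr_ge0// addr_ge0 ?powR_ge0// ltW.
by apply: ge1; rewrite ?ler1n// mulr_ge0// ltW.
Qed.
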